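(* (Metric Closing Lemma) Let $\Gamma$ be a cocompact torsion-free discrete subgroup of the isometry group of $\mathbb{H}^{n+1}$ and let $\delta_0=\log(1+\sqrt2)$. Given $\varepsilon_0>0$, set $s_0=4\varepsilon_0+6\delta_0$. Then there exist a constant $c_0=c_0(\varepsilon_0)\le2\delta_0+\varepsilon_0-\log(\varepsilon_0/8)$ and a length $l_0=l_0(\varepsilon_0)\ge4\delta_0+\varepsilon_0$ with $s_0+l_0\ge2c_0$ and with the following property. Let $l\ge l_0$ and $s>s_0$, and let $\gamma:[0,s+l]\to\mathbb{H}^{n+1}$ be a geodesic segment such that $$d(\gamma(s+t),\psi(\gamma(t)))\le\varepsilon_0\quad\text{for all }t\in[0,l],$$ where $\psi\in\Gamma$ is of hyperbolic type with $|\psi|\ge4\delta_0$. Then $s-2\varepsilon_0\le|\psi|\le s+\varepsilon_0$ and $$\gamma([c_0,s+l-c_0])\subset\mathcal{N}_{\varepsilon_0/8}(A_\psi).$$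
   Context: $\mathbb{H}^{n+1}$ is real hyperbolic space with distance $d$; geodesic segments are parametrized by arc length. For a hyperbolic isometry $\psi$, $A_\psi$ is its axis (the unique geodesic line invariant under $\psi$) and $|\psi|=d(x,\psi(x))$, for any $x\in A_\psi$, is its translation length. $\mathcal{N}_\varepsilon(A_\psi)$ is the $\varepsilon$-neighborhood of $A_\psi$. *)

(* Defs.v *)
From HB Require Import structures.
From mathcomp Require Import all_boot all_order all_algebra.
From mathcomp Require Import ring lra.
From mathcomp Require Import all_classical all_reals all_analysis.

Set Implicit Arguments.
Unset Strict Implicit.
Unset Printing Implicit Defensive.

Import Order.TTheory GRing.Theory Num.Theory.
Import numFieldNormedType.Exports.

Local Open Scope classical_set_scope.
Local Open Scope ring_scope.

Definition arcosh {R : realType} (u : R) : R := ln (u + Num.sqrt (u ^+ 2 - 1)).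

Section Lorentz.
Context {R : realType} {m : nat}.
Implicit Types x y z : 'rV[R]_m.+1.

Definition lorentz x y : R :=
  - (x 0 0 * y 0 0) + \sum_(i < m) x 0 (lift ord0 i) * y 0 (lift ord0 i).

Lemma lorentzC x y : lorentz x y = lorentz y x.
Proof.
by rewrite /lorentz mulrC; congr (_ + _); apply: eq_bigr => i _; rewrite mulrC.
Qed.

Lemma lorentzDl x y z : lorentz (x + y) z = lorentz x z + lorentz y z.
Proof.
rewrite /lorentz !mxE addrACA -big_split/=; congr (_ + _); first by ring.
by apply: eq_bigr => i _; rewrite !mxE mulrDl.
Qed.

Lemma lorentzZl a x z : lorentz (a *: x) z = a * lorentz x z.
Proof.
rewrite /lorentz !mxE mulrDr mulr_sumr; congr (_ + _); first by ring.
by apply: eq_bigr => i _; rewrite !mxE mulrA.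
Qed.

Lemma lorentzDr x y z : lorentz z (x + y) = lorentz z x + lorentz z y.
Proof. by rewrite lorentzC lorentzDl !(lorentzC z). Qed.

Lemma lorentzZr a x z : lorentz z (a *: x) = a * lorentz z x.
Proof. by rewrite lorentzC lorentzZl lorentzC. Qed.

End Lorentz.

(* The hyperboloid model of the hyperbolic space of dimension m: the upper
   sheet of lorentz v v = -1 in R^(m+1). *)
Record hyperbolic_space (R : realType) (m : nat) := Hyperbolic {
  hval :> 'rV[R]_m.+1 ;
  hvalP : (lorentz hval hval == -1) && (0 < hval 0 0) }.

HB.instance Definition _ (R : realType) (m : nat) :=
  [isSub for @hval R m].
HB.instance Definition _ (R : realType) (m : nat) :=
  [Choice of hyperbolic_space R m by <:].

Lemma hyperbolic_origin_subproof (R : realType) (m : nat) :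
  let o : 'rV[R]_m.+1 := delta_mx 0 0 in (lorentz o o == -1) && (0 < o 0 0).
Proof.
rewrite /= /lorentz !mxE !eqxx /= mulr1 ltr01 andbT big1 ?addr0//.
by move=> i _; rewrite !mxE /= mul0r.
Qed.

HB.instance Definition _ (R : realType) (m : nat) :=
  isPointed.Build (hyperbolic_space R m)
    (Hyperbolic (hyperbolic_origin_subproof R m)).

Section HyperbolicMetric.
Context {R : realType} {m : nat}.
Implicit Types x y z : hyperbolic_space R m.

Definition hdist x y : R := arcosh (- lorentz x y).

Lemma hvalE x : lorentz x x = -1.
Proof. by case: x => v /= /andP[/eqP]. Qed.

Lemma hval_gt0 x : 0 < hval x 0 0.
Proof. by case: x => v /= /andP[]. Qed.

Lemma discr_le0 (A C D : R) :
  (forall s t, 0 <= s ^+ 2 * A + 2 * s * t * C + t ^+ 2 * D) ->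
  C ^+ 2 <= A * D.
Proof.
move=> H; have D0 : 0 <= D by have := H 0 1; lra.
have [D_gt0|] := ltrP 0 D.
  have := H D (- C); rewrite (_ : _ + _ = D * (A * D - C ^+ 2)); last by ring.
  by rewrite pmulr_rge0// subr_ge0.
move=> D_le0; have {D0 D_le0} D0 : D = 0 by lra.
rewrite D0 mulr0; have [->|C0] := eqVneq C 0; first by rewrite expr0n.
have := H 1 (- (A + 1) / (2 * C)).
rewrite D0 (_ : _ + _ = -1); first by lra.
by field.
Qed.

Definition euclid_part (v w : 'rV[R]_m.+1) :=
  \sum_(i < m) v 0 (lift ord0 i) * w 0 (lift ord0 i).

Lemma euclid_cs v w :
  euclid_part v w ^+ 2 <= euclid_part v v * euclid_part w w.
Proof.
apply: discr_le0 => s t.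
rewrite /euclid_part !mulr_sumr -!big_split/=; apply: sumr_ge0 => i _.
set a := v _ _; set b := w _ _.
by rewrite (_ : _ + _ = (s * a + t * b) ^+ 2) ?sqr_ge0//; ring.
Qed.

Lemma euclid_ge0 v : 0 <= euclid_part v v.
Proof. by apply: sumr_ge0 => i _; rewrite -expr2 sqr_ge0. Qed.

Lemma lorentz_orth_ge0 y (v : 'rV[R]_m.+1) : lorentz v y = 0 -> 0 <= lorentz v v.
Proof.
have := hvalE y; have := hval_gt0 y; rewrite /lorentz.
rewrite -!/(euclid_part _ _); set a := hval y 0 0; set b := v 0 0.
move=> a0 yE vy; have := euclid_cs v y; have := euclid_ge0 v.
have -> : euclid_part v y = b * a by lra.
have -> : euclid_part y y = a ^+ 2 - 1 by lra.
set V := euclid_part v v => V0 H.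
rewrite addrC subr_ge0 -(ler_pM2r (exprn_gt0 2 a0)).
by apply: le_trans (_ : (b * a) ^+ 2 <= _); nra.
Qed.

Lemma lorentz_orth_cs y (u w : 'rV[R]_m.+1) : lorentz u y = 0 -> lorentz w y = 0 ->
  lorentz u w ^+ 2 <= lorentz u u * lorentz w w.
Proof.
move=> uy wy; apply: discr_le0 => s t.
have := @lorentz_orth_ge0 y (s *: u + t *: w).
rewrite !(lorentzDl, lorentzDr, lorentzZl, lorentzZr) uy wy (lorentzC w u).
move=> /(_ _)/le_trans; apply; [lra | lra].
Qed.

Lemma lorentz_le_m1 x y : 1 <= - lorentz x y.
Proof.
have xE := hvalE x; have yE := hvalE y.
have x0 := hval_gt0 x; have y0 := hval_gt0 y.
move: xE yE; rewrite /lorentz -!/(euclid_part _ _).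
move: (hval x 0 0) (hval y 0 0) x0 y0 => a b a0 b0 xE yE.
have := euclid_cs x y; move: (euclid_part x y) => c.
have -> : euclid_part x x = a ^+ 2 - 1 by lra.
have -> : euclid_part y y = b ^+ 2 - 1 by lra.
have a1 : 1 <= a ^+ 2 by have := euclid_ge0 x; lra.
have b1 : 1 <= b ^+ 2 by have := euclid_ge0 y; lra.
have {}a1 : 1 <= a by rewrite -(@ler_pXn2r _ 2) ?expr1n// nnegrE ltW.
have {}b1 : 1 <= b by rewrite -(@ler_pXn2r _ 2) ?expr1n// nnegrE ltW.
move=> H; suff : c <= a * b - 1 by lra.
have [|/ltW c0] := lerP c 0; first by nra.
rewrite -(@ler_pXn2r _ 2) ?nnegrE//; last by nra.
by apply: le_trans H _; have := sqr_ge0 (a - b); lra.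
Qed.

(* With r = cosh d(x,z), p = cosh d(x,y), q = cosh d(y,z), this says
   cosh d(x,z) <= cosh (d(x,y) + d(y,z)). *)
Lemma lorentz_triangle y x z :
  - lorentz x z <= lorentz x y * lorentz y z
    + Num.sqrt (lorentz x y ^+ 2 - 1) * Num.sqrt (lorentz y z ^+ 2 - 1).
Proof.
pose p := lorentz x y; pose q := lorentz y z.
pose u := hval x + p *: hval y; pose w := hval z + q *: hval y.
have E := (@lorentzDl R m, @lorentzDr R m, @lorentzZl R m, @lorentzZr R m).
have uy : lorentz u y = 0 by rewrite /u !E hvalE /p; ring.
have wy : lorentz w y = 0 by rewrite /w !E hvalE (lorentzC z) /q; ring.
have uu : lorentz u u = p ^+ 2 - 1.
  by rewrite /u /w !E !hvalE (lorentzC y x) -/p; ring.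
have ww : lorentz w w = q ^+ 2 - 1.
  by rewrite /u /w !E !hvalE (lorentzC z y) -/q; ring.
have uw : lorentz u w = lorentz x z + p * q.
  by rewrite /u /w !E !hvalE -/p -/q; ring.
have := lorentz_orth_cs uy wy; rewrite uu ww uw -/p -/q => H.
have uu0 : 0 <= p ^+ 2 - 1 by rewrite -uu (lorentz_orth_ge0 uy).
rewrite -sqrtrM//; suff : - (lorentz x z + p * q)
    <= Num.sqrt ((p ^+ 2 - 1) * (q ^+ 2 - 1)) by lra.
apply: le_trans (ler_norm _) _; rewrite normrN.
by rewrite -sqrtr_sqr ler_wsqrtr.
Qed.

Lemma sqrt_arcosh_ge0 (u : R) : 1 <= u -> 0 <= u ^+ 2 - 1.
Proof. by move=> u1; rewrite subr_ge0 expr_ge1//; lra. Qed.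

Lemma ler_arcosh (u v : R) : 1 <= u -> u <= v -> arcosh u <= arcosh v.
Proof.
move=> u1 uv; have v1 := le_trans u1 uv.
have su := sqrtr_ge0 (u ^+ 2 - 1); have sv := sqrtr_ge0 (v ^+ 2 - 1).
rewrite /arcosh ler_ln ?posrE; try lra.
by rewrite lerD// ler_wsqrtr//; nra.
Qed.

Lemma arcosh_add (p q : R) : 1 <= p -> 1 <= q ->
  arcosh p + arcosh q
  = arcosh (p * q + Num.sqrt (p ^+ 2 - 1) * Num.sqrt (q ^+ 2 - 1)).
Proof.
move=> p1 q1; rewrite /arcosh.
set P := Num.sqrt (p ^+ 2 - 1); set Q := Num.sqrt (q ^+ 2 - 1).
have P0 : 0 <= P by exact: sqrtr_ge0.
have Q0 : 0 <= Q by exact: sqrtr_ge0.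
have PE : P ^+ 2 = p ^+ 2 - 1 by rewrite sqr_sqrtr// sqrt_arcosh_ge0.
have QE : Q ^+ 2 = q ^+ 2 - 1 by rewrite sqr_sqrtr// sqrt_arcosh_ge0.
rewrite (_ : _ ^+ 2 - 1 = (p * Q + q * P) ^+ 2); last first.
  rewrite !sqrrD !exprMn PE QE; ring.
rewrite sqrtr_sqr ger0_norm; last by nra.
rewrite -lnM ?posrE; [|lra..].
by congr ln; ring.
Qed.

Lemma hdistxx x : hdist x x = 0.
Proof.
by rewrite /hdist /arcosh hvalE opprK expr1n subrr sqrtr0 addr0 ln1.
Qed.

Lemma hdist_sym x y : hdist x y = hdist y x.
Proof. by rewrite /hdist lorentzC. Qed.

Lemma hdist_positivity x y : hdist x y = 0 -> x = y.
Proof.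
rewrite /hdist /arcosh => H.
have L1 := lorentz_le_m1 x y.
have S0 := sqrtr_ge0 ((- lorentz x y) ^+ 2 - 1).
have {}H : - lorentz x y + Num.sqrt ((- lorentz x y) ^+ 2 - 1) = 1.
  by apply: ln_inj; rewrite ?posrE ?ln1//; lra.
have {H S0 L1}L : lorentz x y = -1 by lra.
have := hval_gt0 y.
pose v := hval x - hval y.
have vy : lorentz v y = 0.
  by rewrite /v -scaleN1r !(lorentzDl, lorentzZl) hvalE L; ring.
have vv : lorentz v v = 0.
  rewrite /v -scaleN1r !(lorentzDl, lorentzDr, lorentzZl, lorentzZr) !hvalE.
  by rewrite (lorentzC y x) L; ring.
move: (hvalE y) vy vv; rewrite /lorentz -!/(euclid_part _ _).
set a := hval y 0 0; set b := v 0 0 => yE vy vv a0.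
have := euclid_cs v y.
have -> : euclid_part v y = b * a by lra.
have -> : euclid_part y y = a ^+ 2 - 1 by lra.
have VE : euclid_part v v = b * b by lra.
rewrite VE => H.
have b0 : b = 0.
  by apply/eqP; rewrite -sqrf_eq0 eq_le sqr_ge0 andbT; nra.
have {VE vy vv H} /eqP := VE; rewrite b0 mulr0 /euclid_part psumr_eq0; last first.
  by move=> i _; rewrite -expr2 sqr_ge0.
move=> /allP V.
apply/val_inj/eqP; rewrite -subr_eq0; apply/eqP/matrixP => i j.
rewrite (ord1 i) [RHS]mxE -/v.
case: (unliftP ord0 j) => [k ->|->]; last exact: b0.
by have := V k (mem_index_enum _); rewrite /= mulf_eq0 orbb => /eqP.
Qed.

Lemma hdist_triangle y x z : hdist x z <= hdist x y + hdist y z.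
Proof.
rewrite /hdist arcosh_add ?lorentz_le_m1//; apply: ler_arcosh.
  exact: lorentz_le_m1.
by rewrite mulrNN !sqrrN; exact: lorentz_triangle.
Qed.

End HyperbolicMetric.

HB.instance Definition _ (R : realType) (m : nat) :=
  isMetric.Build R (hyperbolic_space R m)
    hdistxx hdist_positivity hdist_sym hdist_triangle.

Section MetricNotions.
Context {R : realType} {X : metricType R}.
Implicit Types (f : X -> X) (A : set X).

Definition isometry f :=
  (forall x y, mdist (f x) (f y) = mdist x y) /\ (forall y, exists x, f x = y).

Definition geodesic_segment (a b : R) (g : R -> X) :=
  {in `[a, b] &, forall t u, mdist (g t) (g u) = `|t - u|}.

Definition geodesic_line A :=
  exists2 g : R -> X, (forall t u, mdist (g t) (g u) = `|t - u|) & A = range g.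

Definition neighborhood (e : R) A : set X :=
  [set x | exists2 a, A a & mdist x a < e].

(* The displacement function x |-> d(x, f x) attains a positive minimum. *)
Definition hyperbolic f := isometry f /\
  exists x, 0 < mdist x (f x) /\ forall y, mdist x (f x) <= mdist y (f y).

(* Meaningful for hyperbolic f, for which the invariant line exists and is
   unique; set0 is the default value of the description operator. *)
Definition axis f : set X :=
  xget set0 [set A | geodesic_line A /\ f @` A = A].

End MetricNotions.

(* The chosen point of the axis is immaterial when f is hyperbolic. *)
Definition translation_length {R : realType} {m : nat}
    (f : hyperbolic_space R m -> hyperbolic_space R m) : R :=
  let x := xget point (axis f) in mdist x (f x).

Record isometry_group (R : realType) (X : metricType R) := IsometryGroup {
  elements : set (X -> X) ;
  elements_isometry : forall f, elements f -> isometry f ;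
  elements_id : elements id ;
  elements_comp : forall f g, elements f -> elements g -> elements (f \o g) ;
  elements_inv : forall f, elements f ->
    exists2 g, elements g & cancel f g /\ cancel g f }.

Section IsometryGroups.
Context {R : realType} {X : metricType R}.
Variable G : isometry_group X.

Definition orbit_rel : rel X := fun x y => `[< exists2 f, elements G f & f x = y >].

Lemma orbit_rel_refl : reflexive orbit_rel.
Proof. by move=> x; apply/asboolP; exists id => //; exact: elements_id. Qed.

Lemma orbit_rel_sym : symmetric orbit_rel.
Proof.
suff H x y : orbit_rel x y -> orbit_rel y x by move=> x y; apply/idP/idP; exact: H.
move=> /asboolP[f Gf <-]; apply/asboolP.
by have [g Gg [fK _]] := elements_inv Gf; exists g.
Qed.

Lemma orbit_rel_trans : transitive orbit_rel.
Proof.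
move=> y x z /asboolP[f Gf <-] /asboolP[g Gg <-]; apply/asboolP.
by exists (g \o f) => //; exact: elements_comp.
Qed.

Definition orbit_equiv : equiv_rel X :=
  EquivRel orbit_rel orbit_rel_refl orbit_rel_sym orbit_rel_trans.

Definition orbit_space : topologicalType :=
  quotient_topology {eq_quot orbit_equiv}%qT.

Definition cocompact := compact [set: orbit_space].

(* The topology of the isometry group is the compact-open one. *)
Definition discrete_subgroup :=
  let Gco : set {compact-open, X -> X} := elements G in Gco `<=` isolated Gco.

Definition torsion_free :=
  forall f k, elements G f -> (0 < k)%N -> iter k f =1 id -> f = id.

End IsometryGroups.

Definition delta0 (R : realType) : R := ln (1 + Num.sqrt 2).

(* Main.v *)
Require Import Defs.
From mathcomp Require Import all_boot all_order all_algebra.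
From mathcomp Require Import ring lra.
From mathcomp Require Import all_classical all_reals all_analysis.

Import Order.TTheory GRing.Theory Num.Theory.
Import numFieldNormedType.Exports.

Local Open Scope classical_set_scope.
Local Open Scope ring_scope.

(* Let P, Q be null vectors representing the endpoints at infinity of the axis
   of psi. The logarithms of -2<Q, .> and -2<P, .> are Busemann functions: they
   are 1-Lipschitz and psi shifts them by |psi| and -|psi|. Along gamma the two
   products are p e^t + q e^-t and p' e^t + q' e^-t with nonnegative
   coefficients. Comparing gamma(s + t) with psi(gamma t) at t = 0 bounds q by a
   multiple of p; if |psi| were less than s - 2 eps0 the first product would
   then grow too fast between l and s + l, for l large. At t = l the comparison
   bounds p' e^(2(s + l)) by a multiple of q'. The product of the two functions
   is cosh^2 of the distance to the axis, and these ratios together with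
   Cauchy-Schwarz on the orthogonal complement of span(P, Q) make it close to 1
   away from the ends of gamma. *)

Set Implicit Arguments.
Unset Strict Implicit.

(** * Geodesic lines and axes in the hyperboloid model *)

Section Lines.
Context {R : realType} {m : nat}.
Implicit Types (x y z : hyperbolic_space R m) (v w P Q : 'rV[R]_m.+1).

Local Notation lorentzE :=
  (@lorentzDl R m, @lorentzDr R m, @lorentzZl R m, @lorentzZr R m).

(** Cauchy-Schwarz for the projections of [v] and [w] to the orthogonal complement of [x], where the
    form is positive. *)
Lemma lorentz_gram x v w :
  (lorentz v w + lorentz v x * lorentz w x) ^+ 2 <=
  (lorentz v v + lorentz v x ^+ 2) * (lorentz w w + lorentz w x ^+ 2).
Proof.
pose p u : 'rV[R]_m.+1 := u + lorentz u x *: hval x.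
have px u : lorentz (p u) x = 0 by rewrite /p !lorentzE hvalE; ring.
have pp u u' : lorentz (p u) (p u') = lorentz u u' + lorentz u x * lorentz u' x.
  by rewrite {2}/p lorentzDr lorentzZr px mulr0 addr0 /p !lorentzE (lorentzC x u').
by have := lorentz_orth_cs (px v) (px w); rewrite !pp -!expr2.
Qed.

Lemma lorentz_delta0 v : lorentz v (delta_mx 0 0) = - v 0 0.
Proof.
rewrite /lorentz !mxE !eqxx /= mulr1 big1 ?addr0// => i _.
by rewrite !mxE /= mulr0.
Qed.

Lemma lorentz_delta_lift v (i : 'I_m) :
  lorentz v (delta_mx 0 (lift ord0 i)) = v 0 (lift ord0 i).
Proof.
rewrite /lorentz !mxE /= mulr0 oppr0 add0r (bigD1 i)//= !mxE !eqxx mulr1.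
rewrite big1 ?addr0// => j /negPf ji; rewrite !mxE /=.
by rewrite (inj_eq (@lift_inj _ _)) ji mulr0.
Qed.

(** By [lorentz_gram], [v] is orthogonal to every vector; pairing it with the basis vectors kills
    each coordinate. *)
Lemma lorentz_orth_null x v : lorentz v x = 0 -> lorentz v v = 0 -> v = 0.
Proof.
move=> vx vv; have {vx vv}H w : lorentz v w = 0.
  have := lorentz_gram x v w; rewrite vx vv mul0r addr0 expr0n addr0 mul0r => H.
  by apply/eqP; rewrite -sqrf_eq0 eq_le H sqr_ge0.
apply/matrixP => i j; rewrite (ord1 i) [RHS]mxE.
case: (unliftP ord0 j) => [k ->|->]; first by rewrite -lorentz_delta_lift H.
by apply/eqP; rewrite -oppr_eq0 -lorentz_delta0 H.
Qed.

(** The difference of [x] and [v] is null and orthogonal to [x]. A single pairing thus identifies a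
    point, whatever the sheet of [v]. *)
Lemma lorentz_unit_eq x v : lorentz v v = -1 -> lorentz x v = -1 -> hval x = v.
Proof.
move=> vv xv; apply/eqP; rewrite -subr_eq0; apply/eqP/(@lorentz_orth_null x).
  by rewrite -scaleN1r !lorentzE hvalE (lorentzC v x) xv; ring.
by rewrite -scaleN1r !lorentzE hvalE (lorentzC v x) xv vv; ring.
Qed.

Lemma lorentz_unit_time v : lorentz v v = -1 -> 1 <= v 0 0 ^+ 2.
Proof. by rewrite /lorentz => vv; have := euclid_ge0 v; rewrite /euclid_part; lra. Qed.

(** For time coordinates a, b and c = [lorentz x v], [lorentz_gram] at the origin gives (c + ab)^2
    <= (a^2 - 1)(b^2 - 1) <= (ab)^2, impossible when c < 0 and ab <= 0. *)
Lemma lorentz_unit_future x v :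
  lorentz v v = -1 -> lorentz x v < 0 -> 0 < v 0 0.
Proof.
move=> vv xv; have := lorentz_gram (point : hyperbolic_space R m) x v.
rewrite /= !lorentz_delta0 vv hvalE mulrNN !sqrrN.
have := lorentz_unit_time vv; have := lorentz_unit_time (hvalE x).
have := hval_gt0 x.
move: (hval x 0 0) (v 0 0) (lorentz x v) xv => a b c c0 a0 a1 b1 H.
rewrite ltNge; apply/negP => b0.
have cab : 0 <= c * (a * b) by rewrite mulr_le0 ?ltW//; nra.
have c2 : 0 < c ^+ 2 by rewrite exprn_even_gt0//= lt_eqF.
have : (-1 + a ^+ 2) * (-1 + b ^+ 2) <= (a * b) ^+ 2.
  by rewrite exprMn; move: (a ^+ 2) (b ^+ 2) a1 b1 => A B; lra.
nra.
Qed.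

Lemma expR_hdist x y :
  expR (hdist x y) = - lorentz x y + Num.sqrt (lorentz x y ^+ 2 - 1).
Proof.
rewrite /hdist /arcosh sqrrN lnK// posrE.
by have := lorentz_le_m1 x y; have := sqrtr_ge0 (lorentz x y ^+ 2 - 1); lra.
Qed.

Lemma lorentz_hdist x y :
  lorentz x y = - (expR (hdist x y) + expR (- hdist x y)) / 2.
Proof.
have L1 := lorentz_le_m1 x y; rewrite expRN expR_hdist.
have : Num.sqrt (lorentz x y ^+ 2 - 1) ^+ 2 = lorentz x y ^+ 2 - 1.
  by rewrite sqr_sqrtr//; nra.
have := sqrtr_ge0 (lorentz x y ^+ 2 - 1).
move: (Num.sqrt _) => r; move: (lorentz x y) L1 => c L1 r0 rE.
have cr0 : - c + r != 0 by apply/eqP; lra.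
have -> : (- c + r)^-1 = - c - r.
  by apply: (mulfI cr0); rewrite divff//; lra.
lra.
Qed.

Lemma lorentz_hdist_abs x y t : hdist x y = `|t| ->
  lorentz x y = - (expR t + expR (- t)) / 2.
Proof.
by rewrite lorentz_hdist => ->; case: (ger0P t) => // _; rewrite opprK; ring.
Qed.

Lemma hdist_lorentz x y t :
  lorentz x y = - (expR t + expR (- t)) / 2 -> hdist x y = `|t|.
Proof.
have abs_cosh : expR t + expR (- t) = expR `|t| + expR (- `|t|).
  by case: (ger0P t) => // _; rewrite opprK addrC.
rewrite abs_cosh /hdist /arcosh => ->; rewrite sqrrN -[RHS]expRK.
have : expR (- `|t|) <= expR `|t| by rewrite ler_expR; have := normr_ge0 t; lra.
have : expR `|t| * expR (- `|t|) = 1 by rewrite -expRD subrr expR0.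
move: (expR `|t|) (expR (- `|t|)) => a b ab ba; congr ln.
rewrite (_ : _ - 1 = ((a - b) / 2) ^+ 2); last by lra.
by rewrite sqrtr_sqr ger0_norm; lra.
Qed.

(* The geodesic lines are the curves [line P Q] for [null_pair P Q]: the
   directions of [P] and [Q] are the endpoints at infinity. *)
Definition null_pair P Q :=
  [/\ lorentz P P = 0, lorentz Q Q = 0 & lorentz P Q = - 2^-1].

Definition line P Q (t : R) := expR t *: P + expR (- t) *: Q.

Lemma null_pairC P Q : null_pair P Q -> null_pair Q P.
Proof. by case=> PP QQ PQ; split=> //; rewrite lorentzC. Qed.

Lemma lineN P Q t : line P Q (- t) = line Q P t.
Proof. by rewrite /line opprK addrC. Qed.

Lemma lorentz_line P Q v t :
  lorentz v (line P Q t) = expR t * lorentz v P + expR (- t) * lorentz v Q.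
Proof. by rewrite /line !lorentzE. Qed.

Lemma line_lorentz P Q t u : null_pair P Q ->
  lorentz (line P Q t) (line P Q u) = - (expR (t - u) + expR (- (t - u))) / 2.
Proof.
case=> PP QQ PQ; rewrite opprB !expRD lorentz_line /line !lorentzE.
by rewrite PP QQ PQ (lorentzC Q P) PQ; field.
Qed.

Lemma line_unit P Q t : null_pair P Q -> lorentz (line P Q t) (line P Q t) = -1.
Proof. by move=> PQ; rewrite line_lorentz// subrr oppr0 expR0; field. Qed.

Lemma expR_det_neq0 (a b : R) : a != b ->
  expR a * expR (- b) - expR b * expR (- a) != 0.
Proof.
move=> ab; rewrite -!expRD subr_eq0; apply: contra ab => /eqP/expR_inj H.
by apply/eqP; lra.
Qed.

(** The two distances give a linear system for [lorentz z P] and [lorentz z Q], invertible since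
    [a != b]; [lorentz_unit_eq] concludes. *)
Lemma hval_line P Q a b t x y z : null_pair P Q -> a != b ->
  hval x = line P Q a -> hval y = line P Q b ->
  hdist z x = `|t - a| -> hdist z y = `|t - b| -> hval z = line P Q t.
Proof.
move=> PQ ab xE yE /lorentz_hdist_abs; rewrite xE lorentz_line => zx.
move=> /lorentz_hdist_abs; rewrite yE lorentz_line => zy.
have D := @expR_det_neq0 _ _ ab.
move: zx zy; rewrite !opprB !expRD => zx zy.
have ee (c : R) : expR c * expR (- c) = 1 by rewrite -expRD subrr expR0.
have zP : lorentz z P = - expR (- t) / 2.
  apply: (mulfI D); rewrite mulrBl -!mulrA.
  rewrite [LHS](_ : _ =
    expR (- b) * (expR a * lorentz z P + expR (- a) * lorentz z Q) -
    expR (- a) * (expR b * lorentz z P + expR (- b) * lorentz z Q)); last by ring.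
  by rewrite zx zy; ring.
have zQ : lorentz z Q = - expR t / 2.
  apply: (mulfI D); rewrite mulrBl -!mulrA.
  rewrite [LHS](_ : _ =
    expR a * (expR b * lorentz z P + expR (- b) * lorentz z Q) -
    expR b * (expR a * lorentz z P + expR (- a) * lorentz z Q)); last by ring.
  by rewrite zx zy; ring.
apply: lorentz_unit_eq; first exact: line_unit.
rewrite lorentz_line zP zQ.
by rewrite [LHS](_ : _ = - (expR t * expR (- t))); [rewrite ee|field].
Qed.

Lemma line_through x y a b : a != b -> hdist x y = `|a - b| ->
  exists P Q, [/\ null_pair P Q, hval x = line P Q a & hval y = line P Q b].
Proof.
move=> ab /lorentz_hdist_abs; rewrite opprB !expRD /null_pair /line !expRN.
have := expR_det_neq0 ab; rewrite !expRN.
have := expR_gt0 a; have := expR_gt0 b.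
move: (expR a) (expR b) => A B B0 A0 D xy.
have An : A != 0 by rewrite gt_eqF.
have Bn : B != 0 by rewrite gt_eqF.
have {}D : A ^+ 2 - B ^+ 2 != 0.
  apply: contra D => /eqP D; apply/eqP.
  rewrite (_ : _ - _ = (A ^+ 2 - B ^+ 2) / (A * B)); last by field; rewrite An Bn.
  by rewrite D mul0r.
have xx := hvalE x; have yy := hvalE y; have yx := xy; rewrite lorentzC in yx.
(* Solution of x = A P + A^-1 Q, y = B P + B^-1 Q for P and Q. *)
exists ((A ^+ 2 - B ^+ 2)^-1 *: (A *: hval x + (- B) *: hval y)).
exists ((A ^+ 2 - B ^+ 2)^-1 *: ((A * B) *: (A *: hval y + (- B) *: hval x))).
split; first split.
- by rewrite !lorentzE xx yy xy yx; field; rewrite An Bn D.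
- by rewrite !lorentzE xx yy xy yx; field; rewrite An Bn D.
- by rewrite !lorentzE xx yy xy yx; field; rewrite An Bn D.
- by apply/matrixP => i j; rewrite !mxE; field; rewrite An D.
- by apply/matrixP => i j; rewrite !mxE; field; rewrite Bn D.
Qed.

(** The domain [D] covers both full lines and segments. *)
Lemma geodesic_line_form (D : set R) (g : R -> hyperbolic_space R m) a b :
  D a -> D b -> a != b ->
  (forall t u, D t -> D u -> hdist (g t) (g u) = `|t - u|) ->
  exists P Q, null_pair P Q /\ forall t, D t -> hval (g t) = line P Q t.
Proof.
move=> Da Db ab gD; have [P [Q [PQ ga gb]]] := line_through ab (gD _ _ Da Db).
by exists P, Q; split=> // t Dt; apply: (hval_line PQ ab ga gb); apply: gD.
Qed.

(** Negating both vectors of a null pair moves its line to the other sheet; the point [x] selects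
    the upper one. *)
Lemma null_pair_geodesic P Q x t0 : null_pair P Q -> hval x = line P Q t0 ->
  exists g : R -> hyperbolic_space R m, forall t, hval (g t) = line P Q t.
Proof.
move=> PQ xE; suff H t : (lorentz (line P Q t) (line P Q t) == -1) &&
    (0 < line P Q t 0 0) by exists (fun t => Hyperbolic (H t)).
rewrite line_unit// eqxx /=; apply: (@lorentz_unit_future x); first exact: line_unit.
rewrite xE line_lorentz//.
have := expR_gt0 (t0 - t); have := expR_gt0 (- (t0 - t)); lra.
Qed.

Lemma hdist_line P Q x y t u : null_pair P Q ->
  hval x = line P Q t -> hval y = line P Q u -> hdist x y = `|t - u|.
Proof. by move=> PQ xE yE; apply: hdist_lorentz; rewrite xE yE line_lorentz. Qed.

Lemma hval_inj x y : hval x = hval y -> x = y.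
Proof. exact: val_inj. Qed.

(** * The axis of a hyperbolic isometry *)

Section Axis.
Variable f : hyperbolic_space R m -> hyperbolic_space R m.
Hypothesis f_hyp : hyperbolic f.

Let fI x y : hdist (f x) (f y) = hdist x y.
Proof. by case: f_hyp => -[H _] _; exact: H. Qed.

Lemma hyperbolic_fixfree x : f x != x.
Proof.
apply/eqP => fx; case: f_hyp => _ [y [y0 /(_ x)]].
by rewrite fx mdistxx; lra.
Qed.

Lemma axis_exists : exists A, geodesic_line A /\ f @` A = A.
Proof.
have [x [d [d0 xfx dmin]]] : exists x d,
    [/\ 0 < d, hdist x (f x) = `|0 - d| & forall y, d <= hdist y (f y)].
  case: f_hyp => _ [x [d0 dmin]]; exists x, (hdist x (f x)); split=> //.
  by rewrite sub0r normrN gtr0_norm.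
have d0n : 0 != d by rewrite lt_eqF.
have [P [Q [PQ xE fxE]]] := line_through d0n xfx.
have [g gE] := null_pair_geodesic PQ xE.
have gd t u : hdist (g t) (g u) = `|t - u| by apply: (hdist_line PQ).
have g0 : g 0 = x by apply: hval_inj; rewrite gE.
have g1 : g d = f x by apply: hval_inj; rewrite gE.
have f0 : f (g 0) = g d by rewrite g0.
(* The displacement of the midpoint of [x, f x] is at most d through f x, and
   at least d by minimality, so f moves it along the same line. *)
have f1 : f (g (d / 2)) = g (d / 2 + d).
  have dn : d != d / 2 by apply/eqP; lra.
  apply: hval_inj; rewrite gE; apply: (hval_line PQ dn (gE _) (gE _)).
    by rewrite -f0 fI gd; congr `|_|; lra.
  apply/eqP; rewrite eq_le; apply/andP; split.
    apply: le_trans (hdist_triangle (g d) _ _) _.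
    rewrite -{1}f0 fI !gd.
    by case: (ger0P (d / 2 - 0)) => ?; case: ger0P => ?; case: ger0P => ?; lra.
  by rewrite addrAC subrr add0r gtr0_norm// hdist_sym dmin.
(* The images of two points of the line are now known, and by [hval_line] they determine all the
   others. *)
have fg t : f (g t) = g (t + d).
  have dn : d != d / 2 + d by apply/eqP; lra.
  apply: hval_inj; rewrite gE; apply: (hval_line PQ dn (gE _) (gE _)).
    by rewrite -f0 fI gd; congr `|_|; lra.
  by rewrite -f1 fI gd; congr `|_|; lra.
exists (range g); split; first by exists g.
apply/seteqP; split=> [_ [_ [t _ <-] <-]|_ [t _ <-]]; first by exists (t + d).
by exists (g (t - d)); [exists (t - d)|rewrite fg subrK].
Qed.

Lemma axis_line : exists P Q (g : R -> hyperbolic_space R m),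
  [/\ null_pair P Q, forall t, hval (g t) = line P Q t, axis f = range g &
      forall t, f (g t) = g (t + translation_length f)].
Proof.
have [A AP] := axis_exists.
(* [axis_exists] rules out the default value [set0]. *)
have [[g0 g0d axE] faxis] : geodesic_line (axis f) /\ f @` axis f = axis f.
  exact: (@xgetPex _ set0 [set A | geodesic_line A /\ f @` A = A] (ex_intro _ A AP)).
have : f @` range g0 = range g0 by rewrite -axE.
move=> {}faxis.
have [P [Q [PQ gE]]] : exists P Q, null_pair P Q /\
    forall t, setT t -> hval (g0 t) = line P Q t.
  apply: (@geodesic_line_form setT g0 0 1) => //; first by rewrite eq_sym oner_neq0.
  by move=> t u _ _; exact: g0d.
have {}gE t : hval (g0 t) = line P Q t by exact: gE.
have gd t u : hdist (g0 t) (g0 u) = `|t - u| by exact: g0d.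
have fr t : exists u, f (g0 t) = g0 u.
  have : range g0 (f (g0 t)) by rewrite -faxis; exists (g0 t) => //; exists t.
  by case=> u _ uE; exists u.
have [c c0] := fr 0; have [c' c1] := fr 1.
have cc : `|c' - c| = 1 by rewrite -gd -c0 -c1 fI gd subr0 normr1.
have fg t : f (g0 t) = g0 (t + c).
  (* On the parameter, [f] is either t + c or the reflection c - t; the latter would fix
     [g0 (c / 2)]. *)
  have [c'E|c'E] : c' = c + 1 \/ c' = c - 1.
    by move: cc; case: (ger0P (c' - c)) => _ ?; [left|right]; lra.
  - have cn : c != c' by apply/eqP; lra.
    apply: hval_inj; rewrite gE; apply: (hval_line PQ cn (gE _) (gE _)).
      by rewrite -c0 fI gd; congr `|_|; lra.
    by rewrite -c1 fI gd; congr `|_|; lra.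
  - have cn : c != c' by apply/eqP; lra.
    have /negP[] := hyperbolic_fixfree (g0 (c / 2)).
    apply/eqP/hval_inj; rewrite gE; apply: (hval_line PQ cn (gE _) (gE _)).
      by rewrite -c0 fI gd -normrN; congr `|_|; lra.
    by rewrite -c1 fI gd -normrN; congr `|_|; lra.
have tl : translation_length f = `|c|.
  rewrite /translation_length.
  have : axis f (xget point (axis f)) 
    by apply: xgetPex; exists (g0 0); rewrite axE; exists 0.
  rewrite {1}axE => -[t _ <-]; rewrite fg.
  by rewrite [LHS]gd -normrN; congr `|_|; lra.
have [c_ge0|c_lt0] := ger0P c.
  by exists P, Q, g0; split=> // t; rewrite tl ger0_norm.
(* When c < 0 the line is reversed, so that [f] translates in the positive direction. *)
exists Q, P, (g0 \o -%R); split=> /=.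
- exact: null_pairC.
- by move=> t; rewrite gE lineN.
- rewrite axE; apply/seteqP; split=> _ [t _ <-]; exists (- t) => //=.
  by rewrite opprK.
- by move=> t; rewrite fg tl ltr0_norm// opprD opprK.
Qed.

End Axis.
End Lines.

(** * Real estimates *)

Section Estimates.
Context {R : realType}.
Lemma sqr_le_mul4 (x y z : R) :
  0 <= y -> 0 <= z -> x ^+ 2 <= 4 * y * z -> x <= y + z.
Proof.
move=> y0 z0 xyz; rewrite leNgt; apply/negP => lt_x.
have : 0 < (x - (y + z)) * (x + (y + z)) by rewrite mulr_gt0; lra.
by have := sqr_ge0 (y - z); lra.
Qed.

(* For a geodesic gamma with gamma(s + t) within eps0 of psi (gamma t):
   E = e^eps0, S = e^s, L = e^l, T = e^|psi|, and the Busemann functions at the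
   endpoints of the axis are p e^t + q e^-t and p' e^t + q' e^-t at gamma t. *)
Record closing_data (E S L T p q p' q' : R) : Prop := ClosingData {
  cd_E : 1 <= E ;
  cd_S : 190 * E ^+ 4 <= S ;
  cd_T : 1 <= T ;
  cd_L : 1 <= L ;
  cd_p : 0 <= p ;
  cd_q : 0 <= q ;
  cd_p' : 0 <= p' ;
  cd_q' : 0 <= q' ;
  cd_pq : 0 < p + q ;
  cd_a_start : T * (p + q) <= E * (S * p + q / S) ;
  cd_a_stop : S * L * p + q / (S * L) <= E * (T * (L * p + q / L)) ;
  cd_b_stop : T * (S * L * p' + q' / (S * L)) <= E * (L * p' + q' / L) ;
  cd_cs : (p * q' + p' * q - 1) ^+ 2 <= 4 * (p * p') * (q * q') }.

Variables (E S L T p q p' q' : R).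
Hypothesis cd : closing_data E S L T p q p' q'.

Lemma S_ge_100E : 100 * E <= S.
Proof.
case: cd => E1 SE T1 L1 p0 q0 p'0 q'0 pq0 a_start a_stop b_stop w_cs.
have : E <= E ^+ 4 by rewrite ler_eXnr.
move: (E ^+ 4) SE => X; lra.
Qed.

Lemma S_gt0 : 0 < S.
Proof. case: cd => *; have := S_ge_100E; lra. Qed.

Lemma TS_ge_100E : 100 * E <= T * S.
Proof.
case: cd => E1 SE T1 L1 p0 q0 p'0 q'0 pq0 a_start a_stop b_stop w_cs.
by apply: le_trans S_ge_100E _; rewrite ler_peMl// ltW// S_gt0.
Qed.

Lemma translation_upper : T <= E * S.
Proof.
case: cd => E1 SE T1 L1 p0 q0 p'0 q'0 pq0 a_start a_stop b_stop w_cs.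
have S0 := S_gt0; have S1 : 1 <= S by have := S_ge_100E; lra.
rewrite -(ler_pM2r pq0); apply: (le_trans a_start); rewrite -mulrA.
rewrite ler_pM2l; last by lra.
rewrite mulrDr lerD2l (@le_trans _ _ q)//.
  by rewrite ler_pdivrMr// ler_peMr.
by rewrite ler_peMl.
Qed.

(** [cd_a_start] times [S]; the [q] term on the right is absorbed because E <= T S / 100. *)
Lemma start_ratio_a : 99 / 100 * (T * q) <= E * (S * p).
Proof.
case: cd => E1 SE T1 L1 p0 q0 p'0 q'0 pq0 a_start a_stop b_stop w_cs.
have S0 := S_gt0; rewrite -(ler_pM2r S0).
have := ler_wpM2r (ltW S0) a_start.
rewrite (_ : E * (_ + _) * S = E * S ^+ 2 * p + E * q); last by field; rewrite gt_eqF.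
have := ler_wpM2r q0 TS_ge_100E.
have : 0 <= T * S * p by rewrite !mulr_ge0//; lra.
lra.
Qed.

(** [cd_a_stop] with denominators cleared and the lone [q] on the left dropped. *)
Lemma stop_ratio_a : L ^+ 2 * p * (S - E * T) <= E * T * q.
Proof.
case: cd => E1 SE T1 L1 p0 q0 p'0 q'0 pq0 a_start a_stop b_stop w_cs.
have S0 := S_gt0; have L0 : 0 < L by lra.
rewrite -(ler_pM2r S0).
have := ler_wpM2r (ltW (mulr_gt0 S0 L0)) a_stop.
rewrite (_ : (S * L * p + _) * _ = S ^+ 2 * L ^+ 2 * p + q); last first.
  by field; rewrite !gt_eqF.
rewrite (_ : E * (_ * (_ + _)) * _ = E * T * S * (L ^+ 2 * p + q)); last first.
  by field; rewrite !gt_eqF.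
lra.
Qed.

(** In [cd_b_stop] with denominators cleared, E <= T S / 100 absorbs the [p'] term on the right. *)
Lemma stop_ratio_b : 99 / 100 * (T * S * (L ^+ 2 * p')) <= E * q'.
Proof.
case: cd => E1 SE T1 L1 p0 q0 p'0 q'0 pq0 a_start a_stop b_stop w_cs.
have S0 := S_gt0; have L0 : 0 < L by lra.
rewrite -(ler_pM2r S0).
have := ler_wpM2r (ltW (mulr_gt0 S0 L0)) b_stop.
rewrite (_ : T * (_ + _) * _ = T * (S ^+ 2 * L ^+ 2 * p' + q')); last first.
  by field; rewrite !gt_eqF.
rewrite (_ : E * (_ + _) * _ = E * S * (L ^+ 2 * p' + q')); last first.
  by field; rewrite !gt_eqF.
have SLp : 0 <= S * L ^+ 2 * p' by rewrite !mulr_ge0// ?exprn_ge0//; lra.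
have := ler_wpM2r SLp TS_ge_100E.
have : 0 <= T * q' by rewrite mulr_ge0//; lra.
lra.
Qed.

(** If T E N < S, then S - E T >= S (1 - 1/N), and the two ratio bounds on p and q give L^2 (1 -
    1/N) <= (100/99) E^2. The proof of the theorem takes N = 2 and N = E. *)
Lemma translation_lower N :
  1 < N -> 3 * E ^+ 2 < L ^+ 2 * (1 - N^-1) -> S <= T * E * N.
Proof.
case: cd => E1 SE T1 L1 p0 q0 p'0 q'0 pq0 a_start a_stop b_stop w_cs.
move=> N1 LN; rewrite leNgt; apply/negP => TS.
have S0 := S_gt0; have N0 : 0 < N by lra.
have p_gt0 : 0 < p.
  rewrite lt_neqAle p0 andbT; apply/eqP => p_eq0.
  have : 0 < T * q by rewrite mulr_gt0//; lra.
  by have := start_ratio_a; rewrite -p_eq0; lra.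
have Lp : 0 < L ^+ 2 * p by rewrite mulr_gt0// exprn_gt0//; lra.
have gap : S * (1 - N^-1) <= S - E * T.
  by rewrite mulrBr mulr1 lerD2l lerN2 ler_pdivlMr//; lra.
have := le_trans (ler_wpM2l (ltW Lp) gap) stop_ratio_a.
have Sp : 0 < S * p by rewrite mulr_gt0.
have : 3 * E ^+ 2 * (S * p) < L ^+ 2 * (1 - N^-1) * (S * p) by rewrite ltr_pM2r.
have := ler_wpM2l (le_trans ler01 E1) start_ratio_a.
have : 0 < E ^+ 2 * (S * p) by rewrite mulr_gt0// exprn_gt0//; lra.
lra.
Qed.

(** The factor 203/100 rounds up 2 * 100/99. *)
Lemma q_le_p : S <= T * E * 2 -> q <= 203 / 100 * E ^+ 2 * p.
Proof.
case: cd => E1 SE T1 L1 p0 q0 p'0 q'0 pq0 a_start a_stop b_stop w_cs.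
move=> ST.
have T0 : 0 < T by lra.
rewrite -(ler_pM2l T0); have := start_ratio_a.
have Ep : 0 <= E * p by rewrite mulr_ge0//; lra.
have := ler_wpM2l Ep ST.
have : 0 <= T * E ^+ 2 * p by rewrite !mulr_ge0// ?exprn_ge0//; lra.
lra.
Qed.

Lemma p'_le_q' : S <= T * E * 2 -> (S * L) ^+ 2 * p' <= 203 / 100 * E ^+ 2 * q'.
Proof.
case: cd => E1 SE T1 L1 p0 q0 p'0 q'0 pq0 a_start a_stop b_stop w_cs.
move=> ST.
have S0 := S_gt0; have := ler_wpM2l (le_trans ler01 E1) stop_ratio_b.
have SLp : 0 <= S * L ^+ 2 * p' by rewrite !mulr_ge0// ?exprn_ge0//; lra.
have := ler_wpM2l SLp ST.
have : 0 <= E ^+ 2 * q' by rewrite mulr_ge0// exprn_ge0//; lra.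
lra.
Qed.

(** Put k = p q' and j = p' q. The two ratio bounds give j <= k / 100, so [cd_cs] yields (k + j -
    1)^2 <= (k / 5)^2, whence k - 1 <= k / 5. *)
Lemma pq'_le : S <= T * E * 2 -> p * q' <= 5 / 4.
Proof.
case: cd => E1 SE T1 L1 p0 q0 p'0 q'0 pq0 a_start a_stop b_stop w_cs.
move=> ST.
have pq'0 : 0 <= p * q' by rewrite mulr_ge0.
have : p' * q <= p * q' / 100.
  have SL0 : 0 < (S * L) ^+ 2 by rewrite exprn_gt0// mulr_gt0 ?S_gt0//; lra.
  rewrite -(ler_pM2l SL0).
  have : (S * L) ^+ 2 * (p' * q) <= (203 / 100) ^+ 2 * E ^+ 4 * (p * q').
    have := ler_pM _ q0 (p'_le_q' ST) (q_le_p ST).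
    rewrite mulr_ge0//; last by rewrite ltW.
    move=> /(_ isT); rewrite !mulrA => /le_trans; apply.
    by rewrite le_eqVlt; apply/orP; left; apply/eqP; ring.
  move=> /le_trans; apply; rewrite mulrA mulrAC.
  suff /(ler_wpM2r pq'0) : (203 / 100) ^+ 2 * E ^+ 4 <= (S * L) ^+ 2 / 100 by lra.
  have E4 : 1 <= E ^+ 4 by exact: exprn_ege1.
  have : S <= S * L by rewrite ler_peMr// ltW// S_gt0.
  move: (S * L) (E ^+ 4) SE E4 => X Y; nra.
have : 0 <= p' * q by rewrite mulr_ge0.
move: w_cs; rewrite (_ : 4 * _ * _ = 4 * (p * q') * (p' * q)); last by ring.
move: (p * q') (p' * q) pq'0 => k j k0 cs j0 jk.
by rewrite leNgt; apply/negP => k_gt; nra.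
Qed.

(** Expand into p p' U^2, q q' / U^2 and the cross terms. By [cd_cs] and AM-GM the cross terms
    exceed 1 by at most the sum of the other two. Each of those is at most b / C^2 <= e^2 / 8, since
    [b] bounds both q q' and p p' (S L)^2. *)
Lemma product_near_one e C U : S <= T * E * 2 -> 0 < e -> 29 / 5 * E / e <= C ->
  C <= U -> U <= S * L / C ->
  (p * U + q / U) * (p' * U + q' / U) <= 1 + e ^+ 2 / 2.
Proof.
case: cd => E1 _ _ _ p0 q0 p'0 q'0 _ _ _ _ w_cs ST e0 Ce CU UC.
have E0 : 0 < E by lra.
have C0 : 0 < C by apply: lt_le_trans Ce; rewrite divr_gt0// mulr_gt0//; lra.
have U0 : 0 < U by lra.
have C2 : 3364 / 100 * E ^+ 2 <= C ^+ 2 * e ^+ 2.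
  have : 29 / 5 * E <= C * e by rewrite -ler_pdivrMr.
  have : 0 <= 29 / 5 * E by lra.
  rewrite -exprMn; move: (C * e) => X; nra.
pose b := 203 / 100 * E ^+ 2 * (p * q').
have bC : b <= C ^+ 2 * (e ^+ 2 / 8).
  have E2 : 0 <= E ^+ 2 by rewrite exprn_ge0// ltW.
  have := ler_wpM2l E2 (pq'_le ST); rewrite /b; lra.
have mq : q * q' / U ^+ 2 <= e ^+ 2 / 8.
  rewrite ler_pdivrMr ?exprn_gt0//.
  apply: (@le_trans _ _ b); first by have := ler_wpM2r q'0 (q_le_p ST); rewrite /b; lra.
  apply: (le_trans bC); rewrite mulrC; apply: ler_wpM2l.
    by rewrite divr_ge0// sqr_ge0.
  by rewrite ler_sqr// nnegrE ltW.
have mp : p * p' * U ^+ 2 <= e ^+ 2 / 8.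
  apply: (@le_trans _ _ (p * p' * (S * L / C) ^+ 2)).
    by rewrite ler_wpM2l// ?mulr_ge0// ler_sqr ?nnegrE//; lra.
  rewrite expr_div_n mulrA ler_pdivrMr ?exprn_gt0//.
  apply: (@le_trans _ _ b); first by have := ler_wpM2l p0 (p'_le_q' ST); rewrite /b; lra.
  by rewrite mulrC.
rewrite [leLHS](_ : _ =
  p * p' * U ^+ 2 + q * q' / U ^+ 2 + (p * q' + p' * q)); last first.
  by field; rewrite gt_eqF.
have mp0 : 0 <= p * p' * U ^+ 2 by rewrite !mulr_ge0// ltW.
have mq0 : 0 <= q * q' / U ^+ 2 by rewrite !mulr_ge0// invr_ge0 exprn_ge0// ltW.
have cs : (p * q' + p' * q - 1) ^+ 2 <= 4 * (p * p' * U ^+ 2) * (q * q' / U ^+ 2).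
  apply: (le_trans w_cs); rewrite le_eqVlt; apply/orP; left; apply/eqP.
  by field; rewrite gt_eqF.
have : p * q' + p' * q - 1 <= p * p' * U ^+ 2 + q * q' / U ^+ 2.
  exact: sqr_le_mul4.
have : 0 <= e ^+ 2 by rewrite exprn_ge0// ltW.
lra.
Qed.
End Estimates.

(** * Busemann functions *)

Section Busemann.
Context {R : realType} {m : nat}.
Implicit Types (x y z : hyperbolic_space R m) (v w N M P Q : 'rV[R]_m.+1).

Local Notation lorentzE :=
  (@lorentzDl R m, @lorentzDr R m, @lorentzZl R m, @lorentzZr R m).

(** With n, k, c the pairings of N x, N y, y x, [lorentz_gram] reads (k + nc)^2 <= n^2 (c^2 - 1); as
    nc > 0, this excludes k >= 0. *)
Lemma null_future N x y : lorentz N N = 0 -> lorentz N x < 0 -> lorentz N y < 0.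
Proof.
move=> NN Nx; have := lorentz_gram x N y; rewrite NN hvalE add0r.
have := lorentz_le_m1 y x.
move: (lorentz N x) (lorentz N y) (lorentz y x) Nx => n k c n0 c1 H.
rewrite ltNge; apply/negP => k0.
have nc : 0 < n * c by nra.
have : 0 <= k * (n * c) by rewrite mulr_ge0// ltW.
have : 0 < n ^+ 2 by rewrite exprn_even_gt0//= lt_eqF.
have := sqr_ge0 k; lra.
Qed.

(* The logarithm of [- lorentz N y] is a Busemann function at the point at
   infinity [N], hence 1-Lipschitz. *)
Lemma null_lipschitz N x y : lorentz N N = 0 -> lorentz N x < 0 ->
  - lorentz N y <= expR (hdist x y) * - lorentz N x.
Proof.
move=> NN Nx; have := lorentz_gram x N y; rewrite NN hvalE add0r.
rewrite expR_hdist (lorentzC x y); have := lorentz_le_m1 y x.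
have := sqrtr_ge0 (lorentz y x ^+ 2 - 1).
have : lorentz y x ^+ 2 - 1 = Num.sqrt (lorentz y x ^+ 2 - 1) ^+ 2.
  by rewrite sqr_sqrtr//; have := lorentz_le_m1 y x; nra.
move: (Num.sqrt _) => r.
move: (lorentz N x) (lorentz N y) (lorentz y x) Nx => n k c n0 rE r0 c1 H.
suff : `|k + n * c| <= - n * r by rewrite ler_norml => /andP[? _]; lra.
have nr : 0 <= - n * r by nra.
rewrite -ler_sqr ?nnegrE// real_normK ?num_real// (le_trans H)//.
by rewrite exprMn sqrrN -rE; lra.
Qed.

(** Source of the nonnegativity of p, q, p', q'. For a, b the pairings with [x], (c + ab)^2 <=
    (ab)^2 with ab > 0 excludes c > 0. *)
Lemma null_null N M x : lorentz N N = 0 -> lorentz M M = 0 ->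
  lorentz N x < 0 -> lorentz M x < 0 -> lorentz N M <= 0.
Proof.
move=> NN MM Nx Mx; have := lorentz_gram x N M; rewrite NN MM !add0r.
move: (lorentz N x) (lorentz M x) (lorentz N M) Nx Mx => a b c a0 b0 H.
rewrite leNgt; apply/negP => c0.
have : 0 < c * (a * b) by rewrite pmulr_rgt0//; nra.
have : 0 < c ^+ 2 by rewrite exprn_gt0.
lra.
Qed.

Lemma null_pair_neg P Q x y t : null_pair P Q -> hval x = line P Q t ->
  lorentz P y < 0.
Proof.
move=> [PP QQ PQ] xE; apply: (@null_future _ x) => //.
by rewrite xE lorentz_line PP PQ; have := expR_gt0 (- t); lra.
Qed.

(** Project [P'] and [Q'] to the orthogonal complement of span(P, Q). It lies in the complement of
    [x], so Cauchy-Schwarz holds there. *)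
Lemma null_pair_cs P Q P' Q' x t (p q p' q' : R) :
  null_pair P Q -> null_pair P' Q' -> hval x = line P Q t ->
  p = - 2 * lorentz Q P' -> q = - 2 * lorentz Q Q' ->
  p' = - 2 * lorentz P P' -> q' = - 2 * lorentz P Q' ->
  (p * q' + p' * q - 1) ^+ 2 <= 4 * (p * p') * (q * q').
Proof.
move=> [PP QQ PQ] [PP' QQ' PQ'] xE pE qE p'E q'E.
pose u : 'rV[R]_m.+1 := P' + (- p) *: P + (- p') *: Q.
pose w : 'rV[R]_m.+1 := Q' + (- q) *: P + (- q') *: Q.
have QP : lorentz Q P = - 2^-1 by rewrite lorentzC.
have uP : lorentz u P = 0.
  by rewrite /u !lorentzE PP QP (lorentzC P') p'E; field.
have uQ : lorentz u Q = 0.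
  by rewrite /u !lorentzE QQ PQ (lorentzC P') pE; field.
have wP : lorentz w P = 0.
  by rewrite /w !lorentzE PP QP (lorentzC Q') q'E; field.
have wQ : lorentz w Q = 0.
  by rewrite /w !lorentzE QQ PQ (lorentzC Q') qE; field.
have ux : lorentz u x = 0 by rewrite xE lorentz_line uP uQ !mulr0 addr0.
have wx : lorentz w x = 0 by rewrite xE lorentz_line wP wQ !mulr0 addr0.
have := lorentz_orth_cs ux wx.
have -> : lorentz u w = (p * q' + p' * q - 1) / 2.
  rewrite {1}/w !lorentzDr !lorentzZr uP uQ /u !lorentzE PQ' pE qE p'E q'E.
  by field.
have -> : lorentz u u = p * p'.
  rewrite {2}/u !lorentzDr !lorentzZr uP uQ /u !lorentzE PP' pE p'E.
  by field.
have -> : lorentz w w = q * q'.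
  rewrite {2}/w !lorentzDr !lorentzZr wP wQ /w !lorentzE QQ' qE q'E.
  by field.
rewrite expr_div_n; move: (_ ^+ 2) => X; lra.
Qed.

(** Linearity of [f] is not assumed: invariance of the pairing of [y] with [g t] gives e^t X + e^-t
    Y = 0, and t = 0, 1 force X = Y = 0. *)
Lemma translation_null P Q (g : R -> hyperbolic_space R m)
    (f : hyperbolic_space R m -> hyperbolic_space R m) T :
  (forall x y, hdist (f x) (f y) = hdist x y) ->
  (forall t, hval (g t) = line P Q t) -> (forall t, f (g t) = g (t + T)) ->
  forall y, expR T * lorentz P (f y) = lorentz P y /\
            lorentz Q (f y) = expR T * lorentz Q y.
Proof.
move=> fI gE fg y; rewrite !(lorentzC P) !(lorentzC Q).
have H t : expR t * (expR T * lorentz (f y) P - lorentz y P)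
    + expR (- t) * (expR (- T) * lorentz (f y) Q - lorentz y Q) = 0.
  have : lorentz (f y) (f (g t)) = lorentz y (g t) by rewrite !lorentz_hdist fI.
  by rewrite fg !gE !lorentz_line opprD !expRD; lra.
have T0 : expR (- T) != 0 by rewrite gt_eqF// expR_gt0.
have TT : expR T * expR (- T) = 1 by rewrite -expRD subrr expR0.
have := H 0; have := H 1; have := @expR_det_neq0 R 1 0 (oner_neq0 _).
rewrite oppr0 expR0 !mul1r mulr1 => D.
set X := expR T * _ - _; set Y := expR (- T) * _ - _ => H1 H0.
have X0 : X = 0 by apply: (mulfI D); rewrite (_ : X = - Y) in H1 *; lra.
have Y0 : Y = 0 by lra.
split; first by apply/eqP; rewrite -subr_eq0 -/X X0.
by apply: (mulfI T0); rewrite mulrA [_ * expR T]mulrC TT mul1r; rewrite /Y in Y0; lra.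
Qed.

(* [4 * lorentz P y * lorentz Q y] is cosh^2 of the distance from y to the line. *)
Lemma dist_line_lt P Q (g : R -> hyperbolic_space R m) y e :
  null_pair P Q -> (forall t, hval (g t) = line P Q t) -> 0 < e ->
  4 * (lorentz P y * lorentz Q y) <= 1 + e ^+ 2 / 2 ->
  exists t, hdist y (g t) < e.
Proof.
move=> PQ gE e0 H.
have Py := null_pair_neg y PQ (gE 0).
have Qy : lorentz Q y < 0.
  by apply: (null_pair_neg y (null_pairC PQ) (x := g 0) (t := - 0)); rewrite lineN.
pose A := Num.sqrt (- lorentz P y); pose B := Num.sqrt (- lorentz Q y).
have A0 : 0 < A by rewrite sqrtr_gt0; lra.
have B0 : 0 < B by rewrite sqrtr_gt0; lra.
have AE : A ^+ 2 = - lorentz P y by rewrite sqr_sqrtr//; lra.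
have BE : B ^+ 2 = - lorentz Q y by rewrite sqr_sqrtr//; lra.
(* The foot of the perpendicular from [y]: e^t A^2 + e^-t B^2 attains its minimum 2 A B where e^t =
   B / A. *)
exists (ln (B / A)); rewrite -ltr_expR expR_hdist gE lorentz_line.
rewrite expRN lnK ?posrE ?divr_gt0// (lorentzC y P) (lorentzC y Q).
have -> : B / A * lorentz P y + (B / A)^-1 * lorentz Q y = - (2 * A * B).
  have -> : lorentz P y = - A ^+ 2 by rewrite AE opprK.
  have -> : lorentz Q y = - B ^+ 2 by rewrite BE opprK.
  by field; rewrite !gt_eqF.
have C2 : (2 * A * B) ^+ 2 <= 1 + e ^+ 2 / 2.
  by rewrite !exprMn AE BE; lra.
have C0 : 0 < 2 * A * B by rewrite !mulr_gt0.
move: (2 * A * B) C0 C2 => C C0 C2; rewrite opprK sqrrN.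
(* The target is C + sqrt(C^2 - 1) < exp(e), where exp(e) = exp(e/2)^2 >= 1 + e + e^2/4. *)
have C_le : C <= 1 + e ^+ 2 / 4.
  by rewrite leNgt; apply/negP => C_gt; have := sqr_ge0 (C - 1); nra.
have r_lt : Num.sqrt (C ^+ 2 - 1) < e.
  by rewrite -[ltRHS](ger0_norm (ltW e0)) -sqrtr_sqr ltr_sqrt ?exprn_gt0//; nra.
have : 1 + e / 2 <= expR (e / 2) by exact: expR_ge1Dx.
have -> : expR e = expR (e / 2) ^+ 2 by rewrite expr2 -expRD; congr expR; field.
move: (expR _) => z; nra.
Qed.

End Busemann.

(** * From a nearly closed geodesic to the real inequalities *)

Section Closing.
Context {R : realType} {m : nat}.
Implicit Types (x y : hyperbolic_space R m) (N P Q : 'rV[R]_m.+1).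

Lemma null_close N x y e : lorentz N N = 0 -> lorentz N x < 0 ->
  hdist x y <= e -> - lorentz N y <= expR e * - lorentz N x.
Proof.
move=> NN Nx xye; apply: le_trans (null_lipschitz y NN Nx) _.
by rewrite ler_pM2r ?oppr_gt0// ler_expR.
Qed.

(** The factor -2 makes the product of the two functions cosh^2 of the distance to the axis. [f]
    multiplies the pairing with [Q] by e^tau and divides that with [P] by it; the closing hypothesis
    is used at t = 0 for [Q] and at t = l for both. *)
Lemma closing_data_geodesic P Q (g : R -> hyperbolic_space R m)
    (f : hyperbolic_space R m -> hyperbolic_space R m) tau
    P' Q' (gam : R -> hyperbolic_space R m) e s l :
  null_pair P Q -> (forall t, hval (g t) = line P Q t) ->
  (forall x y, hdist (f x) (f y) = hdist x y) ->
  (forall t, f (g t) = g (t + tau)) ->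
  null_pair P' Q' ->
  (forall t, 0 <= t <= s + l -> hval (gam t) = line P' Q' t) ->
  (forall t, 0 <= t <= l -> hdist (gam (s + t)) (f (gam t)) <= e) ->
  0 <= e -> 0 <= s -> 0 <= l -> 0 <= tau -> 190 * expR e ^+ 4 <= expR s ->
  closing_data (expR e) (expR s) (expR l) (expR tau)
    (- 2 * lorentz Q P') (- 2 * lorentz Q Q')
    (- 2 * lorentz P P') (- 2 * lorentz P Q').
Proof.
move=> PQ gE fI fg PQ' gamE close e0 s0 l0 tau0 Es.
have Pneg y : lorentz P y < 0 by exact: (null_pair_neg y PQ (gE 0)).
have Qneg y : lorentz Q y < 0.
  by apply: (null_pair_neg y (null_pairC PQ) (x := g 0) (t := - 0)); rewrite lineN.
have gam0 : hval (gam 0) = line P' Q' 0 by apply: gamE; lra.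
have P'neg : lorentz P' (gam 0) < 0 by exact: null_pair_neg PQ' gam0.
have Q'neg : lorentz Q' (gam 0) < 0.
  by apply: (null_pair_neg _ (null_pairC PQ') (x := gam 0) (t := - 0)); rewrite lineN.
have [[PP QQ _] [PP' QQ' _]] := (PQ, PQ').
have start : hdist (gam s) (f (gam 0)) <= e by rewrite -[s]addr0 close; lra.
have stop : hdist (gam (s + l)) (f (gam l)) <= e by rewrite close; lra.
have [Pf Qf] := (fun y => (translation_null fI gE fg y).1,
                 fun y => (translation_null fI gE fg y).2).
have lE N t : 0 <= t <= s + l -> lorentz N (gam t) =
    expR t * lorentz N P' + (expR t)^-1 * lorentz N Q'.
  by move=> tsl; rewrite gamE// lorentz_line expRN.
split.
- by rewrite -expR0 ler_expR.
- by [].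
- by rewrite -expR0 ler_expR.
- by rewrite -expR0 ler_expR.
- by have := null_null QQ PP' (Qneg _) P'neg; lra.
- by have := null_null QQ QQ' (Qneg _) Q'neg; lra.
- by have := null_null PP PP' (Pneg _) P'neg; lra.
- by have := null_null PP QQ' (Pneg _) Q'neg; lra.
- by have := Qneg (gam 0); rewrite lE ?expR0 ?invr1; lra.
- have := null_close QQ (Qneg _) start.
  rewrite Qf !lE ?expR0 ?invr1; [|lra..].
  lra.
- rewrite hdist_sym in stop; have := null_close QQ (Qneg _) stop.
  rewrite Qf !lE ?expRD ?invfM; [|lra..].
  lra.
- rewrite hdist_sym in stop; have := null_close PP (Pneg _) stop.
  move=> /(ler_wpM2l (expR_ge0 tau)); rewrite [leRHS]mulrCA !mulrN Pf.
  rewrite !lE; [|lra..].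
  rewrite expRD !invfM; lra.
- exact: (null_pair_cs PQ PQ' (gE 0)).
Qed.

End Closing.

(** * Numerical bounds for [delta0] *)

Section Constants.
Context {R : realType}.

Lemma delta0_ge0 : 0 <= delta0 R.
Proof. by rewrite ln_ge0// lerDl sqrtr_ge0. Qed.

(** The exact value is (1 + sqrt 2)^2 = 3 + 2 sqrt 2, about 5.83. *)
Lemma expR_2delta0 : 29 / 5 <= expR (2 * delta0 R).
Proof.
have q2 : Num.sqrt 2 ^+ 2 = 2 :> R by rewrite sqr_sqrtr.
have q0 : 0 <= Num.sqrt 2 :> R by exact: sqrtr_ge0.
rewrite (_ : 2 * _ = delta0 R + delta0 R); last by ring.
rewrite expRD /delta0 lnK ?posrE; last lra.
by move: (Num.sqrt 2) q2 q0 => q q2 q0; nra.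
Qed.

Lemma expR_4delta0 : 33 <= expR (4 * delta0 R).
Proof.
rewrite (_ : 4 * _ = 2 * delta0 R + 2 * delta0 R); last by ring.
by rewrite expRD; have := expR_2delta0; nra.
Qed.

Lemma expR_6delta0 : 190 <= expR (6 * delta0 R).
Proof.
rewrite (_ : 6 * _ = 4 * delta0 R + 2 * delta0 R); last by ring.
rewrite expRD; have := expR_2delta0; have := expR_4delta0.
move: (expR _) (expR _) => a b; nra.
Qed.

Lemma expRM4 (e : R) : expR (4 * e) = expR e ^+ 4.
Proof. by rewrite mulrC expRM_natr. Qed.

End Constants.

(** * Choice of the constants and conclusion *)

Unset Implicit Arguments.
Set Strict Implicit.

Theorem proposition3p16 (R : realType) (eps0 : R) (eps0_gt0 : 0 < eps0) :
  let s0 := 4 * eps0 + 6 * delta0 R in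
  exists c0 l0 : R,
    [/\ c0 <= 2 * delta0 R + eps0 - ln (eps0 / 8),
        4 * delta0 R + eps0 <= l0 &
        2 * c0 <= s0 + l0] /\
    forall (n : nat) (Gamma : isometry_group (hyperbolic_space R n.+1)),
      cocompact Gamma -> torsion_free Gamma -> discrete_subgroup Gamma ->
    forall l s : R, l0 <= l -> s0 < s ->
    forall gamma : R -> hyperbolic_space R n.+1,
      geodesic_segment 0 (s + l) gamma ->
    forall psi : hyperbolic_space R n.+1 -> hyperbolic_space R n.+1,
      elements Gamma psi -> hyperbolic psi -> 4 * delta0 R <= translation_length psi ->
      (forall t, t \in `[0, l] -> mdist (gamma (s + t)) (psi (gamma t)) <= eps0) ->
      s - 2 * eps0 <= translation_length psi <= s + eps0 /\
      gamma @` [set` `[c0, s + l - c0]] `<=` neighborhood (eps0 / 8) (axis psi).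
Proof.
move=> s0; have d0 := @delta0_ge0 R.
have e8 : 0 < eps0 / 8 by lra.
pose c0 := 2 * delta0 R + eps0 - ln (eps0 / 8).
have c0_ge0 : 0 <= c0 by have := ln_sublinear e8; rewrite /c0; lra.
have i0 : 0 < eps0^-1 by rewrite invr_gt0.
(* [c0] is the largest value allowed. In [l0], the term 16 / eps0 dominates 2 ln (8 / eps0) in 2 c0,
   and makes L (E - 1) large even when eps0 is small. *)
exists c0, (4 * delta0 R + 4 * eps0 + 16 / eps0); split.
  split=> //; first lra.
  have : 0 < (eps0 / 8)^-1 by rewrite invr_gt0.
  by move=> /ln_sublinear; rewrite lnV// invf_div /c0 /s0; lra.
move=> n Gamma _ _ _ l s ll0 ss0 gam gamI psi _ psi_hyp tau4 close.
have l_ge0 : 0 <= l by lra.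
have s_ge0 : 0 <= s by rewrite /s0 in ss0; lra.
have tau0 : 0 <= translation_length psi by lra.
have Es : 190 * expR eps0 ^+ 4 <= expR s.
  apply: (@le_trans _ _ (expR s0)); last by rewrite ler_expR ltW.
  by rewrite /s0 expRD -expRM4 mulrC ler_wpM2l ?expR_ge0// expR_6delta0.
have [P [Q [g [PQ gE axE fg]]]] := axis_line psi_hyp.
have psiI x y : hdist (psi x) (psi y) = hdist x y.
  by case: psi_hyp => -[H _] _; exact: H.
have [P' [Q' [PQ' gamE]]] : exists P' Q', null_pair P' Q' /\
    forall t, 0 <= t <= s + l -> hval (gam t) = line P' Q' t.
  have sl : 0 < s + l by rewrite /s0 in ss0; lra.
  apply: (@geodesic_line_form _ _ (fun t => 0 <= t <= s + l) gam 0 (s + l)).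
  - by lra.
  - by lra.
  - by rewrite lt_eqF.
  - by move=> t u t01 u01; apply: gamI; rewrite in_itv.
have {}close t : 0 <= t <= l -> hdist (gam (s + t)) (psi (gam t)) <= eps0.
  by move=> tl; apply: close; rewrite in_itv.
have cd := closing_data_geodesic PQ gE psiI fg PQ' gamE close
  (ltW eps0_gt0) s_ge0 l_ge0 tau0 Es.
set tau := translation_length psi in tau0 tau4 fg cd *.
have E_ge : 1 + eps0 <= expR eps0 by exact: expR_ge1Dx.
have L_ge : 33 * expR eps0 ^+ 4 * (1 + 16 / eps0) <= expR l.
  apply: (@le_trans _ _ (expR (4 * delta0 R + 4 * eps0 + 16 / eps0))); last first.
    by rewrite ler_expR.
  rewrite !expRD -expRM4; apply: ler_pM.
  - by rewrite mulr_ge0// expR_ge0.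
  - by lra.
  - by rewrite ler_wpM2r ?expR_ge0// expR_4delta0.
  - exact: expR_ge1Dx.
have E2 : 1 <= expR eps0 ^+ 2 by rewrite exprn_ege1//; lra.
have L33 : 33 * expR eps0 ^+ 2 <= expR l.
  apply: le_trans L_ge.
  rewrite (_ : expR eps0 ^+ 4 = expR eps0 ^+ 2 * expR eps0 ^+ 2); last by rewrite -exprD.
  move: (expR _ ^+ 2) E2 => X X1; have : X <= X * X by rewrite ler_peMr//; lra.
  have : 0 <= X * X / eps0 by rewrite divr_ge0//; [nra|exact: ltW].
  lra.
(* The case N = 2 supplies the hypothesis of the ratio bounds. *)
have ST2 : expR s <= expR tau * expR eps0 * 2.
  apply: (translation_lower cd); first lra.
  move: (expR _ ^+ 2) (expR l) E2 L33 => X L X1 XL.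
  have : 33 * L <= L ^+ 2 by rewrite expr2 ler_wpM2r//; lra.
  lra.
split.
  apply/andP; split.
    (* The case N = E is the lower bound s - 2 eps0. Multiplying L >= 33 E^2 by L (E - 1) >= L eps0
       >= 528 E, with 528 = 33 * 16, gives more than 3 E^3. *)
    have : expR s <= expR tau * expR eps0 * expR eps0.
      apply: (translation_lower cd); first lra.
      have E0 : 0 < expR eps0 by exact: expR_gt0.
      rewrite (_ : 1 - _ = (expR eps0 - 1) / expR eps0); last by field; rewrite gt_eqF.
      rewrite mulrA ltr_pdivlMr//.
      have L_eps : 528 * expR eps0 <= expR l * (expR eps0 - 1).
        apply: (@le_trans _ _ (expR l * eps0)); last by rewrite ler_wpM2l ?expR_ge0//; lra.
        rewrite -ler_pdivrMr//; apply: le_trans L_ge.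
        have : expR eps0 <= expR eps0 ^+ 4 by rewrite ler_eXnr//; lra.
        move=> /(ler_wpM2r (ltW i0)).
        have : 0 <= expR eps0 ^+ 4 by rewrite exprn_ge0// ltW.
        by move: (_ ^+ 4) => X; lra.
      have E528 : 0 <= 528 * expR eps0 by lra.
      have := ler_pM (_ : 0 <= 33 * expR eps0 ^+ 2) E528 L33 L_eps.
      have : 0 < expR eps0 ^+ 3 by rewrite exprn_gt0.
      by move=> ? /(_ (ltac:(lra))); lra.
    by rewrite -!expRD ler_expR; lra.
  by have := translation_upper cd; rewrite -expRD ler_expR; lra.
move=> y [t]; rewrite /= in_itv/= => /andP[t1 t2] <-{y}.
have [u hu] : exists u, hdist (gam t) (g u) < eps0 / 8.
  (* [product_near_one] applies with C = e^c0, U = e^t and e = eps0 / 8; [c0] is designed so that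
     e^c0 = e^(2 delta0) E / (eps0 / 8). *)
  apply: (dist_line_lt PQ gE e8).
  have C0 : expR c0 = expR (2 * delta0 R) * expR eps0 / (eps0 / 8).
    by rewrite /c0 !expRD expRN lnK.
  have Ce : 29 / 5 * expR eps0 / (eps0 / 8) <= expR c0.
    by rewrite C0 !ler_wpM2r ?expR_ge0 ?expR_2delta0// invr_ge0 ltW.
  have Ct : expR c0 <= expR t by rewrite ler_expR.
  have tC : expR t <= expR s * expR l / expR c0.
    by rewrite -expRN -!expRD ler_expR.
  have := product_near_one cd ST2 e8 Ce Ct tC.
  rewrite gamE; last by lra.
  by rewrite !lorentz_line expRN; lra.
by exists (g u) => //; rewrite axE; exists u.
Qed.
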